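(* Let $k$ be a field, let $m$ and $n$ be positive integers, and let $G$ and $H$ be finite simple graphs on the disjoint vertex sets $V(G)=\{1,\dots,m\}$ and $V(H)=\{m+1,\dots,m+n\}$. Then $$\operatorname{ms}(k(G*H))=\max\{\operatorname{ms}(k(G)),\operatorname{ms}(k(H))\}$$ and $$\max\{\operatorname{cs}(k(G)),\operatorname{cs}(k(H))\}\le\operatorname{cs}(k(G*H))\le\operatorname{cs}(k(G))+\operatorname{cs}(k(H)).$$
   Context: The graph join $G*H$ is the graph on $V(G)\cup V(H)$ whose edges are those of $G$, those of $H$, and all pairs $\{i,j\}$ with $i\in V(G)$, $j\in V(H)$. For a finite simple graph $\Gamma$ on a vertex set $V$, the edge ring over $k$ is $k(\Gamma)=k[x_i\mid i\in V]/I(\Gamma)$, where $I(\Gamma)=(x_ix_j\mid\{i,j\}\text{ is an edge of }\Gamma)$; it is standard graded with homogeneous maximal ideal $\bar{\mathfrak m}$ generated by the images of the variables. For a homogeneous ideal $J$ of $k(\Gamma)$, $\mu(J)=\dim_k(J/\bar{\mathfrak m}J)$, and $$\operatorname{cs}(k(\Gamma))=\min\{\mu(J): J\subseteq\bar{\mathfrak m} \text{ homogeneous with } J^2=\bar{\mathfrak m}^2\},\qquad \operatorname{ms}(k(\Gamma))=\min\{\mu(J): J\subseteq \bar{\mathfrak m} \text{ homogeneous with } J\supseteq \bar{\mathfrak m}^2\}.$$ *)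

(* Defs.v *)
From HB Require Import structures.
From mathcomp Require Import all_boot all_order all_algebra.
From mathcomp Require Import mpoly.
From mathcomp Require Import boolp classical_sets.

Set Implicit Arguments.
Unset Strict Implicit.
Unset Printing Implicit Defensive.

Import GRing.Theory.
Import Quotient.
Local Open Scope classical_set_scope.
Local Open Scope ring_scope.
Local Open Scope quotient_scope.

Record sgraph (n : nat) := SGraph {
  edge :> rel 'I_n;
  edge_sym : ssrbool.symmetric edge;
  edge_irr : irreflexive edge }.

Section Join.
Variables (m n : nat) (G : sgraph m) (H : sgraph n).

(* Vertices of G sit in 'I_(m + n) through lshift, those of H through rshift. *)
Definition join_edge : rel 'I_(m + n) := fun i j =>
  match split i, split j with
  | inl a, inl b => G a b
  | inr a, inr b => H a b
  | _, _ => true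
  end.

Fact join_edge_sym : ssrbool.symmetric join_edge.
Proof.
by move=> i j; rewrite /join_edge; case: (split i) => a; case: (split j) => b //;
   rewrite edge_sym.
Qed.

Fact join_edge_irr : irreflexive join_edge.
Proof. by move=> i; rewrite /join_edge; case: (split i) => a; rewrite edge_irr. Qed.

Definition join : sgraph (m + n) := SGraph join_edge_sym join_edge_irr.

End Join.

Section Ideals.
Variable R : comNzRingType.
Implicit Types (I J S : set R).

(* Ideals as Prop-valued sets, the improper ideal included. *)
Definition is_ideal I : Prop :=
  [/\ I 0, forall x y, I x -> I y -> I (x + y) & forall a x, I x -> I (a * x)].

Definition ideal_gen S : set R := smallest is_ideal S.

Definition ideal_mul I J : set R :=
  ideal_gen [set z | exists x y, [/\ I x, J y & z = x * y]].

Lemma ideal_gen_ideal S : is_ideal (ideal_gen S).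
Proof.
split.
- by move=> I [[]].
- by move=> x y Ix Iy K KS; case: (KS) => -[_ KD _] _; apply: KD; [exact: Ix|exact: Iy].
- by move=> a x Ix K KS; case: (KS) => -[_ _ KM] _; apply: KM; exact: Ix.
Qed.

Lemma ideal_gen_sub I S : is_ideal I -> S `<=` I -> ideal_gen S `<=` I.
Proof. exact: smallest_sub. Qed.

Lemma sub_ideal_gen S : S `<=` ideal_gen S.
Proof. exact: sub_gen_smallest. Qed.

End Ideals.

Section QuotientDimension.
Variables (k : fieldType) (V : lmodType k).

(* dim_k (U / W) = d, for subspaces W `<=` U of V: the classes modulo W of
   some b_0, ..., b_(d-1) in U form a basis of U / W. *)
Definition has_quot_dim (U W : set V) (d : nat) : Prop :=
  exists b : 'I_d -> V,
    [/\ forall i, U (b i),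
        forall c : 'I_d -> k, W (\sum_i c i *: b i) -> forall i, c i = 0
      & forall u, U u -> exists c : 'I_d -> k, W (u - \sum_i c i *: b i)].

End QuotientDimension.

Section EdgeRing.
Variables (k : fieldType) (n : nat) (G : sgraph n).

Definition edge_ideal : set {mpoly k[n]} :=
  ideal_gen [set p | exists i j, G i j /\ p = 'X_i * 'X_j].

Definition edge_pred : {pred {mpoly k[n]}} := fun p => `[< edge_ideal p >].

(* Polynomials without terms of degree at most 1. *)
Let ord2 : set {mpoly k[n]} :=
  [set p | forall u : 'X_{1..n}, (mdeg u < 2)%N -> p@_u = 0].

Let ord2_ideal : is_ideal ord2.
Proof.
split=> [u _|p q p2 q2 u u2|a p p2 u u2]; first by rewrite mcoeff0.
  by rewrite mcoeffD p2 // q2 // addr0.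
rewrite mcoeffM big1 // => -[v w] /= /eqP uvw.
rewrite [p@__]p2 ?mulr0 //; apply: leq_ltn_trans u2.
have := leq_addl (mdeg v) (mdeg w); by rewrite -mdegD -uvw.
Qed.

Let ord2_XX i j : ord2 ('X_i * 'X_j).
Proof.
move=> u u2; rewrite -mpolyXD mcoeffX; case: eqP => // ?; subst u.
by move: u2; rewrite mdegD !mdeg1.
Qed.

Let edge_ord2 : edge_ideal `<=` ord2.
Proof.
refine (ideal_gen_sub ord2_ideal _) => p [i [j [_ ->]]]; exact: ord2_XX.
Qed.

Fact edge_pred_idealr : idealr_closed edge_pred.
Proof.
have [I0 ID IM] : is_ideal edge_ideal by exact: ideal_gen_ideal.
split; first exact/asboolP.
  apply/negP => /asboolP/edge_ord2/(_ 0%MM); rewrite mdeg0 mcoeff1 eqxx.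
  by move=> /(_ isT)/eqP; rewrite oner_eq0.
move=> a p q /asboolP Ip /asboolP Iq; apply/asboolP.
by apply: (ID (a * p) q) => //; exact: IM.
Qed.

HB.instance Definition _ := isIdealr.Build _ edge_pred edge_pred_idealr.

Definition edge_ring : Type := {ideal_quot edge_pred}.

HB.instance Definition _ := GRing.ComNzRing.on edge_ring.

Definition edge_pi (p : {mpoly k[n]}) : edge_ring := \pi_({ideal_quot edge_pred}) p.

Fact edge_pi_zmod : zmod_morphism edge_pi.
Proof. by move=> p q; rewrite /edge_pi rmorphB. Qed.

Fact edge_pi_monoid : monoid_morphism edge_pi.
Proof. by split=> [|p q]; rewrite /edge_pi ?rmorph1 ?rmorphM. Qed.

HB.instance Definition _ :=
  GRing.isZmodMorphism.Build {mpoly k[n]} edge_ring edge_pi edge_pi_zmod.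
HB.instance Definition _ :=
  GRing.isMonoidMorphism.Build {mpoly k[n]} edge_ring edge_pi edge_pi_monoid.

Lemma edge_piP (p : {mpoly k[n]}) : edge_pi p = 0 <-> edge_ideal p.
Proof.
rewrite -(rmorph0 edge_pi); split=> [/eqP|Ip].
  by rewrite /edge_pi -idealrBE subr0 => /asboolP.
by apply/eqP; rewrite /edge_pi -idealrBE subr0; exact/asboolP.
Qed.

Lemma edge_pi_surj (x : edge_ring) : exists p, x = edge_pi p.
Proof. by exists (repr x); rewrite /edge_pi reprK. Qed.

Definition edge_scale (c : k) (x : edge_ring) : edge_ring := edge_pi c%:MP * x.

Fact edge_scaleA a b x : edge_scale a (edge_scale b x) = edge_scale (a * b) x.
Proof. by rewrite /edge_scale mulrA -rmorphM /= mpolyCM. Qed.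

Fact edge_scale1 : left_id 1 edge_scale.
Proof. by move=> x; rewrite /edge_scale rmorph1 mul1r. Qed.

Fact edge_scaleDr : right_distributive edge_scale +%R.
Proof. by move=> a x y; rewrite /edge_scale mulrDr. Qed.

Fact edge_scaleDl x : {morph edge_scale^~ x : a b / a + b}.
Proof. by move=> a b; rewrite /edge_scale mpolyCD rmorphD mulrDl. Qed.

HB.instance Definition _ := GRing.Zmodule_isLmodule.Build k edge_ring
  edge_scaleA edge_scale1 edge_scaleDr edge_scaleDl.

Fact edge_scaleAl (a : k) (x y : edge_ring) : a *: (x * y) = (a *: x) * y.
Proof. exact: mulrA. Qed.

HB.instance Definition _ :=
  GRing.LSemiModule_isLSemiAlgebra.Build k edge_ring edge_scaleAl.

Implicit Types J : set edge_ring.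

Definition edge_max : set edge_ring := ideal_gen (range (fun i => edge_pi 'X_i)).

Definition homog_elt (x : edge_ring) : Prop :=
  exists d (p : {mpoly k[n]}), p \is d.-homog /\ x = edge_pi p.

Definition homog_ideal J : Prop :=
  exists2 S : set edge_ring, S `<=` homog_elt & J = ideal_gen S.

(* mu(J) = d.  A relation rather than a function, so that no default value is
   needed before J / mJ is known to be finite-dimensional. *)
Definition has_mu J (d : nat) : Prop := has_quot_dim J (ideal_mul edge_max J) d.

Definition cs_pred (d : nat) : Prop :=
  exists J, [/\ J `<=` edge_max, homog_ideal J,
    ideal_mul J J = ideal_mul edge_max edge_max & has_mu J d].

Definition ms_pred (d : nat) : Prop :=
  exists J, [/\ J `<=` edge_max, homog_ideal J,
    ideal_mul edge_max edge_max `<=` J & has_mu J d].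

Let homog_edge_max : homog_ideal edge_max.
Proof.
by exists (range (fun i => edge_pi 'X_i)) => // _ [i _ <-]; exists 1%N, 'X_i;
   rewrite dhomogX /= mdeg1.
Qed.

Let mul_edge_max_sub : ideal_mul edge_max edge_max `<=` edge_max.
Proof.
refine (ideal_gen_sub (ideal_gen_ideal _) _).
move=> _ [x [y [_ Iy ->]]]; have [_ _ IM] : is_ideal edge_max by exact: ideal_gen_ideal.
exact: IM.
Qed.

Let max2_ord2 (p : {mpoly k[n]}) :
  ideal_mul edge_max edge_max (edge_pi p) -> ord2 p.
Proof.
have [O0 OD OM] := ord2_ideal.
pose Q : set edge_ring := [set x | exists2 q, ord2 q & x = edge_pi q].
have Qid : is_ideal Q.
  split; first by exists 0; rewrite ?rmorph0.
    by move=> _ _ [q q2 ->] [r r2 ->]; exists (q + r); [exact: OD|rewrite rmorphD].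
  move=> a _ [q q2 ->]; have [r ->] := edge_pi_surj a.
  by exists (r * q); [exact: OM|rewrite rmorphM].
have step1 i y : edge_max y -> Q (edge_pi 'X_i * y).
  move=> My; have [_ QD QM] := Qid; have [Q0 _ _] := Qid.
  apply: (My [set y | Q (edge_pi 'X_i * y)]); split; last first.
    by move=> _ [j _ <-] /=; exists ('X_i * 'X_j); [exact: ord2_XX|rewrite rmorphM].
  split=> [|u v /= Qu Qv|a u /= Qu]; first by rewrite /= mulr0.
    by rewrite mulrDr; exact: QD.
  by rewrite mulrCA; exact: QM.
have Mx x y : edge_max x -> edge_max y -> Q (x * y).
  move=> Mx My; have [Q0 QD QM] := Qid.
  apply: (Mx [set x | Q (x * y)]); split; last first.
    by move=> _ [j _ <-] /=; exact: step1.
  split=> [|u v /= Qu Qv|a u /= Qu]; first by rewrite /= mul0r.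
    by rewrite mulrDl; exact: QD.
  by rewrite -mulrA; exact: QM.
move=> Mp; have [q q2 pq] : Q (edge_pi p).
  by apply: Mp; split=> // _ [x [y [Ix Iy ->]]]; exact: Mx.
have /edge_ord2 pq2 : edge_ideal (p - q) by apply/edge_piP; rewrite rmorphB /= pq subrr.
by rewrite -[p](subrK q); exact: OD.
Qed.

Let sum_scale_pi (I : finType) (c : I -> k) (F : I -> {mpoly k[n]}) :
  \sum_i c i *: edge_pi (F i) = edge_pi (\sum_i c i *: F i).
Proof.
by rewrite rmorph_sum; apply: eq_bigr => i _; rewrite -mul_mpolyC rmorphM.
Qed.

Lemma has_mu_edge_max : has_mu edge_max n.
Proof.
have [M0 MD MM] : is_ideal edge_max by exact: ideal_gen_ideal.
have [S0 SD SM] : is_ideal (ideal_mul edge_max edge_max) by exact: ideal_gen_ideal.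
exists (fun i => edge_pi 'X_i); split.
- by move=> i; apply: sub_ideal_gen; exists i.
- move=> c; rewrite sum_scale_pi => /max2_ord2 c2 i.
  have := c2 U_(i)%MM; rewrite mdeg1 => /(_ isT); rewrite raddf_sum /= (bigD1 i) //=.
  rewrite mcoeffZ mcoeffX eqxx mulr1 big1 ?addr0 // => j ji.
  rewrite mcoeffZ mcoeffX; case: eqP => [/mnmP/(_ j)|]; last by rewrite mulr0.
  by rewrite !mnm1E eqxx eq_sym (negPf ji).
pose P : set edge_ring := [set u | exists c : 'I_n -> k,
  ideal_mul edge_max edge_max (u - \sum_i c i *: edge_pi 'X_i)].
have MX i : edge_max (edge_pi 'X_i) by apply: sub_ideal_gen; exists i.
have Psum (x y : edge_ring) : P x -> P y -> P (x + y).
  move=> [c cP] [d dP]; exists (fun i => c i + d i).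
  under eq_bigr do rewrite scalerDl; rewrite big_split /= opprD addrACA; exact: SD.
suff: edge_max `<=` [set u | edge_max u /\ P u] by move=> sP u /sP[].
refine (ideal_gen_sub _ _); last first.
  move=> _ [i _ <-]; split=> //; exists (fun j => (j == i)%:R).
  rewrite (bigD1 i) //= eqxx scale1r big1 ?addr0 ?subrr // => j /negPf ->.
  by rewrite scale0r.
split.
- split=> //; exists (fun=> 0); rewrite big1 ?subrr // => i _; exact: scale0r.
- by move=> x y [Mx Px] [My Py]; split; [exact: MD|exact: Psum].
move=> a x [Mx [c cP]]; split; first exact: MM.
have [p ->] := edge_pi_surj a.
have [q pE] : exists q, p = (p@_0)%:MP + q /\ q@_0 = 0.
  by exists (p - (p@_0)%:MP); rewrite subrKC mcoeffB mcoeffC eqxx mulr1 subrr.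
have Mq : edge_max (edge_pi q).
  rewrite [q]mpolyE rmorph_sum /=; elim/big_ind: _ => // u _.
  have [->|u0] := eqVneq u 0%MM; first by rewrite (proj2 pE) scale0r rmorph0.
  have [i ui] : exists i, u i != 0%N.
    apply/existsP; apply: contraNT u0; rewrite negb_exists => /forallP h.
    by apply/eqP/mnmP => i; rewrite mnm0E; apply/eqP; move: (h i); rewrite negbK.
  have -> : u = (u - U_(i) + U_(i))%MM by rewrite submK // lep1mP.
  by rewrite mpolyXD -mul_mpolyC mulrA rmorphM /=; exact: MM.
rewrite (proj1 pE) rmorphD /= mulrDl; apply: Psum.
  exists (fun i => p@_0 * c i).
  under eq_bigr do rewrite -scalerA; rewrite -scaler_sumr.
  by rewrite -[edge_pi (mpolyC _ _) * x]/(p@_0 *: x) -scalerBr; exact: SM.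
exists (fun=> 0); rewrite big1 ?subr0 => [|i _]; last exact: scale0r.
by apply: sub_ideal_gen; exists (edge_pi q), x.
Qed.

Fact cs_exists : exists d, `[< cs_pred d >].
Proof.
exists n; apply/asboolP; exists edge_max; split=> //; exact: has_mu_edge_max.
Qed.

Fact ms_exists : exists d, `[< ms_pred d >].
Proof.
exists n; apply/asboolP; exists edge_max; split=> //; exact: has_mu_edge_max.
Qed.

(* The ideal edge_max itself witnesses that both minima are over nonempty sets. *)
Definition cs : nat := ex_minn cs_exists.
Definition ms : nat := ex_minn ms_exists.

End EdgeRing.

(* Main.v *)
(* Let A be the edge ring and m its maximal ideal.  Only linear forms matter:
   cs is the least dimension of a space L of linear forms with L^2 = A_2, and ms
   the least dimension of L with A_1 L = A_2.  For ms this uses an exchange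
   argument, which turns quadratic generators of an ideal containing m^2 into
   linear ones.  The edge ring of a join is a fibre product: its degree 2 part is
   the direct sum of those of k(G) and k(H), and the product of linear forms
   (u1, u2) and (v1, v2) is (u1 v1, u2 v2).  Hence spaces L for the join restrict
   to spaces for G and H.  Conversely, for ms one adds bases of the two spaces
   vector by vector, and for cs one takes the direct sum. *)

From HB Require Import structures.
Require Import Defs.
From mathcomp Require Import all_boot all_algebra.
From mathcomp Require Import mpoly boolp classical_sets.
From mathcomp Require Import zify ring.

Set Implicit Arguments.
Unset Strict Implicit.
Unset Printing Implicit Defensive.

Import GRing.Theory.

(** * Quadratic forms as matrices, and the exchange argument *)

Section QuadraticForms.
Local Open Scope ring_scope.
Variable k : fieldType.

(* A matrix [Z] stands for the quadratic form [\sum_(r, s) Z r s x_r x_s];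
   [null_form G Z] says that this form vanishes in the edge ring.  The diagonal
   is treated apart because of characteristic 2. *)
Definition null_form n (G : sgraph n) (Z : 'M[k]_n) : Prop :=
  (forall r, Z r r = 0) /\ forall r s, ~~ G r s -> Z r s + Z s r = 0.

(* The rows of [f] and [g] are linear forms whose products [f_i g_j] span the
   degree 2 part of the edge ring. *)
Definition spans n (G : sgraph n) d e (f : 'M[k]_(d, n)) (g : 'M[k]_(e, n)) :=
  forall X : 'M[k]_n, exists a : 'M[k]_(d, e), null_form G (X - f^T *m a *m g).

Section OneGraph.
Variables (n : nat) (G : sgraph n).

Lemma null_form0 : null_form G 0.
Proof. by split=> [r|r s _]; rewrite !mxE ?addr0. Qed.

Lemma null_formD X Y : null_form G X -> null_form G Y -> null_form G (X + Y).
Proof.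
move=> [X1 X2] [Y1 Y2]; split=> [r|r s rs]; rewrite !mxE ?X1 ?Y1 ?addr0 //.
by rewrite addrACA X2 // Y2 // addr0.
Qed.

Lemma null_formZ c X : null_form G X -> null_form G (c *: X).
Proof.
move=> [X1 X2]; split=> [r|r s rs]; rewrite !mxE ?X1 ?mulr0 //.
by rewrite -mulrDr X2 // mulr0.
Qed.

Lemma null_formB X Y : null_form G X -> null_form G Y -> null_form G (X - Y).
Proof. by move=> X0 Y0; rewrite -scaleN1r; apply/null_formD/null_formZ. Qed.

Lemma spans_delta d e (f : 'M[k]_(d, n)) (g : 'M[k]_(e, n)) :
  (forall i j, exists a, null_form G (delta_mx i j - f^T *m a *m g)) -> spans G f g.
Proof.
move=> fgE X; rewrite [X]matrix_sum_delta.
pose P (Y : 'M[k]_n) := exists a, null_form G (Y - f^T *m a *m g).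
have PD Y Z : P Y -> P Z -> P (Y + Z).
  move=> [a aY] [b bZ]; exists (a + b).
  by rewrite mulmxDr mulmxDl opprD addrACA; exact: null_formD.
have P0 : P 0 by exists 0; rewrite mulmx0 mul0mx subr0; exact: null_form0.
rewrite -/(P _); elim/big_ind: _ => // i _; elim/big_ind: _ => // j _.
have [a aE] := fgE i j; exists (X i j *: a).
by rewrite -scalemxAr -scalemxAl -scalerBr; exact: null_formZ.
Qed.

Lemma spans_subl d d' e (f : 'M[k]_(d, n)) (f' : 'M[k]_(d', n)) (g : 'M[k]_(e, n)) :
  (f <= f')%MS -> spans G f g -> spans G f' g.
Proof.
move=> /submxP[D ->] fg X; have [a aX] := fg X.
by exists (D^T *m a); rewrite mulmxA -trmx_mul.
Qed.

Lemma spans_subr d e e' (f : 'M[k]_(d, n)) (g : 'M[k]_(e, n)) (g' : 'M[k]_(e', n)) :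
  (g <= g')%MS -> spans G f g -> spans G f g'.
Proof.
move=> /submxP[D ->] fg X; have [a aX] := fg X.
by exists (a *m D); rewrite !mulmxA in aX *.
Qed.

(* As long as some [x_i x_j] is not in [m l], one of the generators involved in
   it can be traded for [x_j], and the rank of the linear parts [l] increases. *)
Lemma spans_exchange d (l : 'M[k]_(d, n)) (B : 'I_d -> 'M[k]_n) :
  (forall X, exists c : 'rV[k]_d, exists a : 'M[k]_(n, d),
     c *m l = 0 /\ null_form G (X - \sum_t c 0 t *: B t - a *m l)) ->
  exists l' : 'M[k]_(d, n), spans G 1%:M l'.
Proof.
have [r] := ubnP (n - \rank l); elim: r l B => // r IHr l B lr lB.
have [|no_span] := pselect (spans G 1%:M l); first by exists l.
have [i [j bad]] : exists i j, forall a : 'M[k]_(n, d),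
    ~ null_form G (delta_mx i j - a *m l).
  apply: contrapT => /forallNP h; apply/no_span/spans_delta => i j.
  apply: contrapT => /forallNP h'; apply: (h i); exists j => a.
  by have := h' a; rewrite trmx1 mul1mx.
have [c [a [cl aE]]] := lB (delta_mx i j).
have [t ct] : exists t, c 0 t != 0.
  apply/existsP; apply: contrapT => /negP; rewrite negb_exists => /forallP c0.
  apply: (bad a); move: aE; rewrite big1 ?subr0 // => s _.
  by move: (c0 s); rewrite negbK => /eqP ->; rewrite scale0r.
(* Row [t] of [l] is traded for x_j. Since [g] is a relation between the rows of [l] with
   coefficient 1 at [t], the row given up is a combination of the others, and [D] below recovers [l]
   from [l']. *)
pose l' := \matrix_s (if s == t then delta_mx 0 j else row s l) : 'M[k]_(d, n).
pose g := (c 0 t)^-1 *: c.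
have gl : g *m l = 0 by rewrite -scalemxAl cl scaler0.
have killt m (v : 'M[k]_(m, d)) : (forall u, v u t = 0) -> v *m l' = v *m l.
  move=> vt; apply/matrixP=> u p; rewrite !mxE; apply: eq_bigr => s _; rewrite !mxE.
  by case: eqP => [->|]; rewrite ?vt ?mul0r // mxE.
pose D := 1%:M - delta_mx t 0 *m g : 'M[k]_d.
have lD : l = D *m l'.
  rewrite killt; first by rewrite mulmxBl mul1mx -mulmxA gl mulmx0 subr0.
  by move=> u; rewrite !mxE big_ord1 !mxE eqxx andbT mulVf // mulr1 subrr.
have jl' : delta_mx 0 j = delta_mx 0 t *m l' :> 'rV_n.
  by rewrite -rowE rowK eqxx.
(* If the row space did not grow, x_j would be a combination of the rows of [l] and x_i x_j would
   lie in m l, against [bad]. *)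
have ll' : (l < l')%MS.
  rewrite /ltmx lD submxMl /= -lD; apply/negP => l'l.
  have /submxP[v vE] : ((delta_mx 0 j : 'rV_n) <= l)%MS.
    by rewrite jl'; apply: submx_trans l'l; exact: submxMl.
  apply: (bad ((delta_mx i 0 : 'cV_n) *m v)).
  by rewrite -mulmxA -vE mul_delta_mx subrr; exact: null_form0.
(* Generator [t] is now the linear form x_j, so its quadratic part is set to 0. *)
apply: (IHr l' (fun s => if s == t then 0 else B s)).
  have := rank_ltmx ll'; have := rank_leq_col l'; have := rank_leq_col l.
  by move: lr; lia.
move=> X; have [c1 [a1 [c1l a1X]]] := lB X.
(* Subtracting [kp] times the expression of x_i x_j clears the coefficient at [t], the only index
   where [l] and [B] have changed. The multiple of x_i x_j this leaves is x_i times row [t] of [l'],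
   whence the term [eit]. *)
pose kp := c1 0 t / c 0 t.
pose c2 := c1 - kp *: c.
have c2t : c2 0 t = 0 by rewrite !mxE divfK // subrr.
pose eit := (delta_mx i 0 : 'cV[k]_n) *m (delta_mx 0 t : 'rV[k]_d).
exists c2, (a1 *m D - kp *: (a *m D) + kp *: eit).
split.
  rewrite killt; first by rewrite mulmxBl c1l -scalemxAl cl scaler0 subrr.
  by move=> u; rewrite ord1.
have -> : \sum_s c2 0 s *: (if s == t then 0 else B s) =
    \sum_s c1 0 s *: B s - kp *: \sum_s c 0 s *: B s.
  rewrite scaler_sumr -sumrB; apply: eq_bigr => s _.
  have -> : c1 0 s *: B s - kp *: (c 0 s *: B s) = c2 0 s *: B s.
    by rewrite !mxE scalerDl scaleNr scalerA.
  by case: eqP => [->|//]; rewrite c2t !scale0r.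
rewrite !mulmxDl !mulNmx -!scalemxAl -!mulmxA -jl' -lD mul_delta_mx.
have -> : forall x s1 s2 u v w : 'M[k]_n,
   x - (s1 - kp *: s2) - (u - kp *: v + kp *: w) = (x - s1 - u) - kp *: (w - s2 - v).
  move=> *; apply/matrixP => ? ?; rewrite !mxE; ring.
by apply: null_formB => //; exact: null_formZ.
Qed.

End OneGraph.

(** * Spanning over the join of two graphs *)

Section Join.
Variables (m n : nat) (G : sgraph m) (H : sgraph n).

(** All mixed pairs are edges, so the off-diagonal blocks carry no condition: the degree 2 part of
    the join is a direct sum. *)
Lemma null_form_join (Z : 'M[k]_(m + n)) : null_form (join G H) Z <->
  null_form G (ulsubmx Z) /\ null_form H (drsubmx Z).
Proof.
have Gl i j : join G H (lshift n i) (lshift n j) = G i j.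
  by rewrite /= /join_edge !(unsplitK (inl _)).
have Hr i j : join G H (rshift m i) (rshift m j) = H i j.
  by rewrite /= /join_edge !(unsplitK (inr _)).
have lr i j : join G H (lshift n i) (rshift m j).
  by rewrite /= /join_edge (unsplitK (inl _)) (unsplitK (inr _)).
have rl i j : join G H (rshift m i) (lshift n j) by rewrite edge_sym.
split=> [[Z0 ZE]|[[G0 GE] [H0 HE]]].
  split; split=> [r|r s rs]; rewrite !mxE ?Z0 //; apply: ZE.
    by rewrite Gl.
  by rewrite Hr.
split=> [r|r s].
  rewrite -[r]splitK; case: (split r) => r' /=; rewrite /unsplit.
    by have := G0 r'; rewrite !mxE.
  by have := H0 r'; rewrite !mxE.
rewrite -[r]splitK -[s]splitK.
case: (split r) => r'; case: (split s) => s'; rewrite [unsplit _]/= [unsplit _]/=;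
  rewrite ?lr ?rl // ?Gl ?Hr => rs.
- by have := GE _ _ rs; rewrite !mxE.
- by have := HE _ _ rs; rewrite !mxE.
Qed.

(** The two factors are coupled only through the coefficients: a single [a] has to serve both. Mixed
    products fall in the off-diagonal blocks and disappear. *)
Lemma spans_joinP d e (f1 : 'M[k]_(d, m)) (f2 : 'M[k]_(d, n))
    (g1 : 'M[k]_(e, m)) (g2 : 'M[k]_(e, n)) :
  spans (join G H) (row_mx f1 f2) (row_mx g1 g2) <->
  forall X Y, exists a, null_form G (X - f1^T *m a *m g1) /\
                        null_form H (Y - f2^T *m a *m g2).
Proof.
have E Z a : null_form (join G H) (Z - (row_mx f1 f2)^T *m a *m row_mx g1 g2) <->
    null_form G (ulsubmx Z - f1^T *m a *m g1) /\
    null_form H (drsubmx Z - f2^T *m a *m g2).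
  rewrite null_form_join tr_row_mx mul_col_mx mul_col_row.
  by rewrite -{1 2}[Z]submxK opp_block_mx add_block_mx block_mxKul block_mxKdr.
split=> [fg X Y|fg Z].
  by have [a /E] := fg (block_mx X 0 0 Y); rewrite block_mxKul block_mxKdr; exists a.
by have [a aZ] := fg (ulsubmx Z) (drsubmx Z); exists a; apply/E.
Qed.

Lemma spans_join_l d e (f : 'M[k]_(d, m + n)) (g : 'M[k]_(e, m + n)) :
  spans (join G H) f g -> spans G (lsubmx f) (lsubmx g).
Proof.
rewrite -{1}[f]hsubmxK -{1}[g]hsubmxK => /spans_joinP fg X.
by have [a [aX _]] := fg X 0; exists a.
Qed.

Lemma spans_join_r d e (f : 'M[k]_(d, m + n)) (g : 'M[k]_(e, m + n)) :
  spans (join G H) f g -> spans H (rsubmx f) (rsubmx g).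
Proof.
rewrite -{1}[f]hsubmxK -{1}[g]hsubmxK => /spans_joinP fg Y.
by have [a [_ aY]] := fg 0 Y; exists a.
Qed.

Lemma spans_join_block d e (f : 'M[k]_(d, m)) (g : 'M[k]_(e, n)) :
  spans G f f -> spans H g g ->
  spans (join G H) (block_mx f 0 0 g) (block_mx f 0 0 g).
Proof.
move=> fG gH; rewrite block_mxEh; apply/spans_joinP => X Y.
have [a aX] := fG X; have [b bY] := gH Y.
(* The rows coming from G and from H are distinct generators here, so [a] and [b] get separate
   diagonal blocks. *)
exists (block_mx a 0 0 b); rewrite !tr_col_mx !trmx0 !mul_row_block !mul_row_col.
by rewrite !(mul0mx, mulmx0, addr0, add0r).
Qed.

(** For a vertex x of G the product x (f_j + g_j) equals x f_j, because x g_j is a combination of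
    edge monomials, and likewise for H. The multipliers from G and from H thus separate the two
    summands of each glued row. *)
Lemma spans_join_row d (f : 'M[k]_(d, m)) (g : 'M[k]_(d, n)) :
  spans G 1%:M f -> spans H 1%:M g -> spans (join G H) 1%:M (row_mx f g).
Proof.
move=> fG gH; rewrite scalar_mx_block block_mxEh; apply/spans_joinP => X Y.
have [a aX] := fG X; have [b bY] := gH Y.
exists (col_mx a b); rewrite !tr_col_mx !trmx0 !mul_row_col.
by rewrite !(mul0mx, mulmx0, addr0, add0r).
Qed.

End Join.

(** Zero rows equalize the numbers of generators, so that two spaces can be added row by row. *)
Lemma spans_pad n (G : sgraph n) d e (l : 'M[k]_(d, n)) :
  (d <= e)%N -> spans G 1%:M l -> exists l' : 'M[k]_(e, n), spans G 1%:M l'.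
Proof.
move=> /subnKC <-; exists (col_mx l (0 : 'M_(e - d, n))).
by apply: spans_subr H; rewrite -addsmxE addsmxSl.
Qed.

End QuadraticForms.

(** * Linear and quadratic forms among polynomials filtered by order *)

Section Forms.
Local Open Scope ring_scope.
Local Open Scope classical_set_scope.
Variables (k : fieldType) (n : nat).
Implicit Types (p q : {mpoly k[n]}) (u v : 'rV[k]_n) (X Y Z : 'M[k]_n).

(** This is the power [e] of the ideal of the variables, described by coefficients. *)
Definition order_ge e : set {mpoly k[n]} :=
  [set p | forall t : 'X_{1..n}, (mdeg t < e)%N -> p@_t = 0].

Lemma order_geM d e p q : order_ge d p -> order_ge e q -> order_ge (d + e) (p * q).
Proof.
move=> dp eq t tde; rewrite mcoeffM big1 // => -[v w] /= /eqP tvw.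
have [vd|dv] := ltnP (mdeg v) d; first by rewrite dp ?mul0r.
rewrite (eq w) ?mulr0 // -(ltn_add2l d); apply: leq_ltn_trans tde.
have := congr1 (@mdeg n) tvw; rewrite mdegD => E.
by apply: leq_trans (eq_leq (esym E)); rewrite leq_add2r.
Qed.

Lemma order_ge0 e : order_ge e 0. Proof. by move=> t _; rewrite mcoeff0. Qed.

Lemma order_geD e p q : order_ge e p -> order_ge e q -> order_ge e (p + q).
Proof. by move=> ep eq t te; rewrite mcoeffD ep // eq // addr0. Qed.

Lemma order_geMl e p q : order_ge e q -> order_ge e (p * q).
Proof. by move=> eq; apply: (@order_geM 0). Qed.

Lemma order_geZ e c p : order_ge e p -> order_ge e (c *: p).
Proof. by move=> ep; rewrite -mul_mpolyC; exact: order_geMl. Qed.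

Lemma order_ge_sum e (I : finType) (F : I -> {mpoly k[n]}) :
  (forall i, order_ge e (F i)) -> order_ge e (\sum_i F i).
Proof.
by move=> eF; elim/big_ind: _ => // [|*]; [exact: order_ge0|exact: order_geD].
Qed.

Lemma order_ge_leq d e p : (d <= e)%N -> order_ge e p -> order_ge d p.
Proof. by move=> de ep t td; apply/ep/leq_trans/de. Qed.

Definition lin v : {mpoly k[n]} := \sum_i v 0 i *: 'X_i.

Definition qform Z : {mpoly k[n]} := \sum_i \sum_j Z i j *: ('X_i * 'X_j).

Lemma lin_is_linear : linear lin.
Proof.
move=> c u v; rewrite /lin scaler_sumr -big_split; apply: eq_bigr => i _ /=.
by rewrite !mxE scalerDl scalerA.
Qed.

HB.instance Definition _ := GRing.isLinear.Build k _ _ _ lin lin_is_linear.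

Lemma qform_is_linear : linear qform.
Proof.
move=> c X Y; rewrite /qform scaler_sumr -big_split; apply: eq_bigr => i _ /=.
rewrite scaler_sumr -big_split; apply: eq_bigr => j _ /=.
by rewrite !mxE scalerDl scalerA.
Qed.

HB.instance Definition _ := GRing.isLinear.Build k _ _ _ qform qform_is_linear.

Lemma lin_delta i : lin (delta_mx 0 i) = 'X_i.
Proof.
rewrite /lin (bigD1 i) //= mxE !eqxx scale1r big1 ?addr0 // => j ji.
by rewrite mxE eqxx (negPf ji) scale0r.
Qed.

Lemma linM u v : lin u * lin v = qform (u^T *m v).
Proof.
rewrite /lin mulr_suml; apply: eq_bigr => i _; rewrite mulr_sumr.
by apply: eq_bigr => j _; rewrite !mxE big_ord1 !mxE -scalerAl -scalerAr scalerA.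
Qed.

Lemma qform_delta i j : qform (delta_mx i j) = 'X_i * 'X_j.
Proof. by rewrite -!lin_delta linM trmx_delta mul_delta_mx. Qed.

Lemma qform_tr Z : qform Z^T = qform Z.
Proof.
rewrite /qform exchange_big; apply: eq_bigr => i _; apply: eq_bigr => j _.
by rewrite mxE mulrC.
Qed.

Lemma qform_mul d e (f : 'M[k]_(d, n)) (a : 'M[k]_(d, e)) (g : 'M[k]_(e, n)) :
  qform (f^T *m a *m g) = \sum_i \sum_j a i j *: (lin (row i f) * lin (row j g)).
Proof.
rewrite [in LHS](matrix_sum_delta a) mulmx_sumr mulmx_suml linear_sum.
apply: eq_bigr => i _; rewrite mulmx_sumr mulmx_suml linear_sum.
apply: eq_bigr => j _; rewrite -scalemxAr -scalemxAl linearZ linM !rowE trmx_mul.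
by rewrite trmx_delta !mulmxA -[_ *m _ *m delta_mx 0 j]mulmxA mul_delta_mx.
Qed.

Lemma order_lin v : order_ge 1 (lin v).
Proof.
apply: order_ge_sum => i; apply: order_geZ => t; rewrite mcoeffX.
by case: eqP => // <-; rewrite mdeg1.
Qed.

Lemma order_qform Z : order_ge 2 (qform Z).
Proof.
do 2![apply: order_ge_sum => ?]; apply: order_geZ.
by rewrite -!lin_delta; apply: (@order_geM 1 1); exact: order_lin.
Qed.

Lemma mcoeff_lin v i : (lin v)@_U_(i) = v 0 i.
Proof.
rewrite /lin raddf_sum /= (bigD1 i) //= mcoeffZ mcoeffX eqxx mulr1.
rewrite big1 ?addr0 // => j ji; rewrite mcoeffZ mcoeffX.
case: eqP => [/mnmP/(_ j)|]; last by rewrite mulr0.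
by rewrite !mnm1E eqxx eq_sym (negPf ji).
Qed.

Lemma mnm1D_eq (i j r s : 'I_n) : (U_(i) + U_(j) == U_(r) + U_(s) :> 'X_{1..n})%MM =
  ((i == r) && (j == s)) || ((i == s) && (j == r)).
Proof.
have cancel1 (a b c : 'I_n) : (U_(a) + U_(b) = U_(a) + U_(c) :> 'X_{1..n})%MM -> b = c.
  by move=> /addmI/eqP; rewrite eq_mnm1 => /eqP.
apply/eqP/orP => [E|[]/andP[/eqP-> /eqP->] //]; last by rewrite addmC.
have [ir|ir] := eqVneq i r.
  by left; rewrite -ir in E; rewrite (cancel1 _ _ _ E) eqxx.
right; have is_ : i = s.
  move: E => /mnmP/(_ i); rewrite !mnmDE !mnm1E eqxx [r == i]eq_sym (negPf ir).
  by rewrite [s == i]eq_sym; case: (i =P s).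
by rewrite -is_ [X in _ = X]addmC in E *; rewrite (cancel1 _ _ _ E) !eqxx.
Qed.

(** Off the diagonal two matrix entries contribute to the same monomial, on it only one; this
    dictates the shape of [null_form]. *)
Lemma mcoeff_qform Z r s : (qform Z)@_(U_(r) + U_(s)) =
  if r == s then Z r r else Z r s + Z s r.
Proof.
have E i j : (Z i j *: ('X_i * 'X_j))@_(U_(r) + U_(s)) =
    Z i j *+ (((i == r) && (j == s)) || ((i == s) && (j == r))).
  by rewrite mcoeffZ -mpolyXD mcoeffX mnm1D_eq mulr_natr.
rewrite /qform raddf_sum /= (bigD1 r) //= raddf_sum /= (bigD1 s) //= E !eqxx /=.
rewrite mulr1n; have [rs|rs] := eqVneq r s; first subst s.
  rewrite [X in _ + X + _]big1 ?addr0 => [|j jr]; last by rewrite E (negPf jr) !andbF.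
  rewrite big1 ?addr0 // => i ir; rewrite raddf_sum big1 //= => j _.
  by rewrite E (negPf ir).
rewrite big1 ?addr0 => [|j js]; last by rewrite E (negPf js) andbF (negPf rs).
rewrite (bigD1 s) 1?eq_sym //= raddf_sum (bigD1 r) //= E !eqxx orbT mulr1n.
rewrite big1 ?addr0 => [|j jr]; last by rewrite E (negPf jr) andbF eq_sym (negPf rs).
rewrite big1 ?addr0 // => i /andP[ir is_]; rewrite raddf_sum big1 //= => j _.
by rewrite E (negPf ir) (negPf is_).
Qed.

Lemma mdeg2P (t : 'X_{1..n}) : mdeg t = 2%N -> exists r s, t = (U_(r) + U_(s))%MM.
Proof.
move=> t2; have [i ti] : exists i, t i != 0%N.
  apply/existsP; apply: contra_eqT t2; rewrite negb_exists => /forallP t0.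
  by rewrite mdegE big1 // => i _; apply/eqP; move: (t0 i); rewrite negbK.
have tE : t = (U_(i) + (t - U_(i)))%MM by rewrite addmC submK // lep1mP.
have /eqP : mdeg (t - U_(i))%MM = 1%N.
  by apply: (@addnI 1); move: t2; rewrite {1}tE mdegD mdeg1.
by move=> /mdeg1P[j /eqP jE]; exists i, j; rewrite -jE.
Qed.

Lemma order1P p : exists2 q, order_ge 1 q & p = (p@_0)%:MP + q.
Proof.
exists (p - (p@_0)%:MP); last by rewrite subrKC.
move=> t; rewrite ltnS leqn0 mdeg_eq0 => /eqP ->.
by rewrite mcoeffB mcoeffC eqxx mulr1 subrr.
Qed.

Lemma order3P p : order_ge 2 p -> exists Z, exists2 q, order_ge 3 q & p = qform Z + q.
Proof.
move=> p2.
(* An upper triangular matrix represents the form without dividing by 2. *)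
pose Z := \matrix_(r, s) (p@_(U_(r) + U_(s)) *+ (r <= s)%N) : 'M[k]_n.
exists Z, (p - qform Z); last by rewrite subrKC.
move=> t; rewrite ltnS leq_eqVlt => /orP[/eqP/mdeg2P[r [s ->]]|t2].
  rewrite mcoeffB mcoeff_qform !mxE leqnn.
  case: eqVneq => [->|rs]; first by rewrite subrr.
  case: ltngtP => [||/val_inj/eqP]; last by rewrite (negPf rs).
    by rewrite addr0 subrr.
  by rewrite add0r addmC subrr.
by rewrite mcoeffB p2 // order_qform // subrr.
Qed.

End Forms.

(** * The edge ring in degrees 1 and 2 *)

Section EdgeRing.
Local Open Scope ring_scope.
Local Open Scope classical_set_scope.
Variables (k : fieldType) (n : nat) (G : sgraph n).
Implicit Types (p q : {mpoly k[n]}) (u v : 'rV[k]_n) (X Y Z : 'M[k]_n).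

Local Notation A := (edge_ring k G).
Local Notation pi := (@edge_pi k n G).
Local Notation mm := (@edge_max k n G).

Lemma edge_piZ c p : pi (c *: p) = c *: pi p.
Proof. by rewrite -mul_mpolyC rmorphM. Qed.

Lemma ideal_scale (I : set A) (c : k) x : is_ideal I -> I x -> I (c *: x).
Proof. by move=> [_ _ IM]; exact: IM. Qed.

Lemma ideal_sum (I : set A) (T : finType) (F : T -> A) :
  is_ideal I -> (forall i, I (F i)) -> I (\sum_i F i).
Proof. by move=> [I0 ID _] IF; elim/big_ind: _ => // *; exact: ID. Qed.

(** Requiring vanishing at every divisor of [t], not only at [t], gives a condition stable under
    multiplication, hence an ideal, and it contains the edge monomials. *)
Lemma edge_ideal_mcoeff p (t : 'X_{1..n}) :
  (forall i j, G i j -> ~~ (U_(i) + U_(j) <= t)%MM) -> edge_ideal G p -> p@_t = 0.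
Proof.
move=> tG pG; pose K : set {mpoly k[n]} :=
  [set q | forall s, (s <= t)%MM -> q@_s = 0].
suff /(_ t) : K p by apply; exact: lepm_refl.
apply: (pG K); split; last first.
  move=> _ [i [j [ij ->]]] s st; rewrite -mpolyXD mcoeffX; case: eqP => // E.
  by move: (tG _ _ ij); rewrite E st.
split=> [s _|x y Kx Ky s st|x y Ky s st]; first by rewrite mcoeff0.
  by rewrite mcoeffD Kx // Ky // addr0.
rewrite mcoeffM big1 // => -[v w] /= /eqP svw; rewrite (Ky w) ?mulr0 //.
by apply: lepm_trans st; have := lem_addl v w; rewrite -svw.
Qed.

(** No edge monomial divides a monomial of degree below 2, and one that divides a monomial of degree
    2 equals it. So the linear part vanishes outright, and the quadratic part vanishes at squares
    and non-edges. *)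
Lemma edge_pi_eq0 v Z p : order_ge 3 p -> pi (lin v + qform Z + p) = 0 ->
  v = 0 /\ null_form G Z.
Proof.
move=> p3 /edge_piP pG.
have nG (t : 'X_{1..n}) : (mdeg t < 2)%N ->
    forall i j, G i j -> ~~ (U_(i) + U_(j) <= t)%MM.
  move=> t2 i j _; apply/negP => /mnm_lepP ijt; move: t2; rewrite ltnNge => /negP; apply.
  have -> : 2%N = mdeg (U_(i) + U_(j) : 'X_{1..n})%MM by rewrite mdegD !mdeg1.
  by rewrite !mdegE; apply: leq_sum.
have nG2 r s : ~~ G r s -> (qform Z)@_(U_(r) + U_(s)) = 0.
  move=> rs; rewrite -[RHS](@edge_ideal_mcoeff _ (U_(r) + U_(s))%MM _ pG).
    rewrite !mcoeffD (p3 (U_(r) + U_(s))%MM) ?mdegD ?mdeg1 // addr0.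
    suff -> : (lin v)@_(U_(r) + U_(s)) = 0 by rewrite add0r.
    rewrite /lin raddf_sum big1 //= => i _; rewrite mcoeffZ mcoeffX.
    case: eqP => [/(congr1 (@mdeg n))|]; last by rewrite mulr0.
    by rewrite mdegD !mdeg1.
  move=> i j ij; apply/negP => le.
  have E : (U_(i) + U_(j) = U_(r) + U_(s) :> 'X_{1..n})%MM.
    rewrite -[RHS](submK le); set d := (_ - _)%MM.
    suff -> : d = 0%MM by rewrite add0m.
    apply/eqP; rewrite -mdeg_eq0; have := congr1 (@mdeg n) (submK le).
    by rewrite -/d !mdegD !mdeg1; lia.
  move/eqP: E; rewrite mnm1D_eq => /orP[]/andP[/eqP iE /eqP jE].
    by move: rs; rewrite -iE -jE ij.
  by move: rs; rewrite edge_sym -iE -jE ij.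
split.
  apply/rowP => i; rewrite mxE -mcoeff_lin.
  rewrite -[RHS](@edge_ideal_mcoeff _ U_(i)%MM _ pG); last by apply: nG; rewrite mdeg1.
  by rewrite !mcoeffD (p3 U_(i)%MM) ?order_qform ?mdeg1 // !addr0.
split=> [r|r s rs].
  by have := nG2 r r; rewrite edge_irr mcoeff_qform eqxx => /(_ isT).
have := nG2 r s rs; rewrite mcoeff_qform; case: eqP => // <- ->; exact: addr0.
Qed.

Lemma null_form_pi Z : null_form G Z -> pi (qform Z) = 0.
Proof.
move=> [Z0 ZE].
(* The strict lower triangle is folded onto the upper one, which leaves the form unchanged and turns
   each entry above the diagonal into [Z r s + Z s r]. *)
pose U := \matrix_(r, s) (if (r <= s)%N then Z r s else 0) : 'M[k]_n.
pose V := \matrix_(r, s) (if (r < s)%N then Z s r else 0) : 'M[k]_n.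
have -> : qform Z = qform (U + V).
  rewrite linearD /= -[qform V]qform_tr -linearD; congr qform.
  by apply/matrixP => r s; rewrite !mxE; case: ltnP; rewrite ?addr0 ?add0r.
rewrite /qform rmorph_sum big1 // => r _; rewrite rmorph_sum big1 // => s _.
rewrite /= edge_piZ; have [rs|rs] := boolP (G r s).
  have -> : pi ('X_r * 'X_s) = 0; last by rewrite scaler0.
  by apply/edge_piP; apply: sub_ideal_gen; exists r, s.
by rewrite !mxE; case: ltngtP => [_|_|/val_inj <-]; rewrite ?ZE // ?Z0 ?addr0 scale0r.
Qed.

(* Linear, respectively quadratic, parts lie in the span of the rows of [f],
   respectively of the products of the rows of [f] and [g]. *)
Definition lin_span d (f : 'M[k]_(d, n)) : set A := [set x |
  exists c : 'rV[k]_d, exists2 p, order_ge 2 p & x = pi (lin (c *m f) + p)].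

Definition quad_span d e (f : 'M[k]_(d, n)) (g : 'M[k]_(e, n)) : set A := [set x |
  exists a : 'M[k]_(d, e), exists2 p, order_ge 3 p &
    x = pi (qform (f^T *m a *m g) + p)].

(** Modulo order 2, a multiplier acts on the linear part through its constant term alone. *)
Lemma lin_span_ideal d (f : 'M[k]_(d, n)) : is_ideal (lin_span f).
Proof.
split.
- exists 0, 0; first exact: order_ge0.
  by rewrite mul0mx linear0 addr0 rmorph0.
- move=> _ _ [c [p p2 ->]] [d' [q q2 ->]]; exists (c + d'), (p + q).
    exact: order_geD.
  by rewrite -rmorphD mulmxDl linearD addrACA.
move=> x _ [c [p p2 ->]]; have [t ->] := edge_pi_surj x.
have [t' t1 tE] := order1P t.
exists (t@_0 *: c), (t' * lin (c *m f) + t * p).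
  apply: order_geD; last exact: order_geMl.
  by apply: (@order_geM _ _ 1 1) => //; exact: order_lin.
by rewrite -rmorphM mulrDr {1}tE mulrDl mul_mpolyC addrA -scalemxAl linearZ.
Qed.

Lemma quad_span_ideal d e (f : 'M[k]_(d, n)) (g : 'M[k]_(e, n)) :
  is_ideal (quad_span f g).
Proof.
split.
- exists 0, 0; first exact: order_ge0.
  by rewrite mulmx0 mul0mx linear0 addr0 rmorph0.
- move=> _ _ [a [p p3 ->]] [b [q q3 ->]]; exists (a + b), (p + q).
    exact: order_geD.
  by rewrite -rmorphD mulmxDr mulmxDl linearD addrACA.
move=> x _ [a [p p3 ->]]; have [t ->] := edge_pi_surj x.
have [t' t1 tE] := order1P t.
exists (t@_0 *: a), (t' * qform (f^T *m a *m g) + t * p).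
  apply: order_geD; last exact: order_geMl.
  by apply: (@order_geM _ _ 1 2) => //; exact: order_qform.
by rewrite -rmorphM mulrDr {1}tE mulrDl mul_mpolyC addrA -scalemxAr -scalemxAl linearZ.
Qed.

(** For elements without constant term, the quadratic part of a product is the product of the linear
    parts. *)
Lemma ideal_mul_quad_span d e (f : 'M[k]_(d, n)) (g : 'M[k]_(e, n)) (I J : set A) :
  I `<=` lin_span f -> J `<=` lin_span g -> ideal_mul I J `<=` quad_span f g.
Proof.
move=> If Jg; refine (ideal_gen_sub (quad_span_ideal f g) _).
move=> _ [x [y [/If[c [p p2 ->]] /Jg[d' [q q2 ->]] ->]]].
exists (c^T *m d'), (lin (c *m f) * q + p * (lin (d' *m g) + q)).
  apply: order_geD; first by apply: (@order_geM _ _ 1 2) => //; exact: order_lin.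
  apply: (@order_geM _ _ 2 1) => //; apply: order_geD; first exact: order_lin.
  exact: order_ge_leq q2.
by rewrite -rmorphM mulrDl mulrDr linM trmx_mul !mulmxA addrA.
Qed.

Lemma edge_max_lin i : mm (pi 'X_i). Proof. by apply: sub_ideal_gen; exists i. Qed.

Lemma edge_max_ideal : is_ideal mm. Proof. exact: ideal_gen_ideal. Qed.

Lemma lin_in_edge_max v : mm (pi (lin v)).
Proof.
rewrite /lin rmorph_sum; apply: (ideal_sum edge_max_ideal) => i.
rewrite /= edge_piZ; apply: (ideal_scale _ edge_max_ideal); exact: edge_max_lin.
Qed.

Lemma edge_max_lin_span : mm `<=` lin_span 1%:M.
Proof.
refine (ideal_gen_sub (lin_span_ideal _) _) => _ [i _ <-].
exists (delta_mx 0 i), 0; first exact: order_ge0.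
by rewrite mulmx1 lin_delta addr0.
Qed.

Lemma order1_edge_max p : order_ge 1 p -> mm (pi p).
Proof.
move=> p1; rewrite [p]mpolyE rmorph_sum /=; have [M0 MD MM] := edge_max_ideal.
elim/big_ind: _ => // t _.
have [->|t0] := eqVneq t 0%MM; first by rewrite p1 ?mdeg0 // scale0r rmorph0.
have [i ti] : exists i, t i != 0%N.
  apply/existsP; apply: contraNT t0; rewrite negb_exists => /forallP h.
  by apply/eqP/mnmP => i; rewrite mnm0E; apply/eqP; move: (h i); rewrite negbK.
have -> : t = (t - U_(i) + U_(i))%MM by rewrite submK // lep1mP.
by rewrite mpolyXD -mul_mpolyC mulrA rmorphM /=; apply: MM; exact: edge_max_lin.
Qed.

(** With one factor fixed, the other factors whose product lies in [I] form an ideal; so each factor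
    in turn may be taken to be a variable. *)
Lemma edge_max2_sub (I : set A) : is_ideal I ->
  (forall i j, I (pi ('X_i * 'X_j))) -> ideal_mul mm mm `<=` I.
Proof.
move=> [I0 ID IM] IX; refine (ideal_gen_sub _ _) => // _ [x [y [mx my ->]]].
apply: (mx [set x | I (x * y)]); split; last first.
  move=> _ [i _ <-] /=; apply: (my [set y | I (pi 'X_i * y)]); split; last first.
    by move=> _ [j _ <-] /=; have := IX i j; rewrite rmorphM.
  split=> [|u v /= Iu Iv|a u /= Iu]; first by rewrite /= mulr0.
    by rewrite mulrDr; exact: ID.
  by rewrite mulrCA; exact: IM.
split=> [|u v /= Iu Iv|a u /= Iu]; first by rewrite /= mul0r.
  by rewrite mulrDl; exact: ID.
by rewrite -mulrA; exact: IM.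
Qed.

Lemma qform_edge_max2 Z : ideal_mul mm mm (pi (qform Z)).
Proof.
have I2 : is_ideal (ideal_mul mm mm) by exact: ideal_gen_ideal.
rewrite /qform rmorph_sum; apply: (ideal_sum I2) => i.
rewrite rmorph_sum; apply: (ideal_sum I2) => j; rewrite /= edge_piZ.
apply: (ideal_scale _ I2); apply: sub_ideal_gen.
by exists (pi 'X_i), (pi 'X_j); rewrite rmorphM; split=> //; exact: edge_max_lin.
Qed.

Lemma ideal_mulS (I I' J J' : set A) :
  I `<=` I' -> J `<=` J' -> ideal_mul I J `<=` ideal_mul I' J'.
Proof.
move=> II' JJ'; refine (ideal_gen_sub (ideal_gen_ideal _) _) => _ [x [y [Ix Jy ->]]].
by apply: sub_ideal_gen; exists x, y; split; [exact: II'|exact: JJ'|].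
Qed.

Lemma qform_mul_in d e (f : 'M[k]_(d, n)) (a : 'M[k]_(d, e)) (g : 'M[k]_(e, n))
    (I J : set A) :
  (forall i, I (pi (lin (row i f)))) -> (forall j, J (pi (lin (row j g)))) ->
  ideal_mul I J (pi (qform (f^T *m a *m g))).
Proof.
move=> If Jg; have IJ : is_ideal (ideal_mul I J) by exact: ideal_gen_ideal.
rewrite qform_mul rmorph_sum; apply: (ideal_sum IJ) => i.
rewrite rmorph_sum; apply: (ideal_sum IJ) => j; rewrite /= edge_piZ rmorphM.
apply: (ideal_scale _ IJ); apply: sub_ideal_gen.
by exists (pi (lin (row i f))), (pi (lin (row j g))).
Qed.

Lemma edge_max2_sub_mul d e (f : 'M[k]_(d, n)) (g : 'M[k]_(e, n)) (I J : set A) :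
  spans G f g ->
  (forall i, I (pi (lin (row i f)))) -> (forall j, J (pi (lin (row j g)))) ->
  ideal_mul mm mm `<=` ideal_mul I J.
Proof.
move=> fg If Jg; refine (edge_max2_sub (ideal_gen_ideal _) _) => i j.
have [a /null_form_pi] := fg (delta_mx i j).
rewrite linearB /= rmorphB qform_delta => /eqP; rewrite subr_eq0 => /eqP ->.
exact: qform_mul_in.
Qed.

(** * Ideals generated by linear forms *)

Definition lin_ideal d (f : 'M[k]_(d, n)) : set A :=
  ideal_gen (range (fun i => pi (lin (row i f)))).

Section LinearIdeal.
Variables (d : nat) (f : 'M[k]_(d, n)).

Lemma lin_ideal_gen i : lin_ideal f (pi (lin (row i f))).
Proof. by apply: sub_ideal_gen; exists i. Qed.

Lemma lin_ideal_sub_max : lin_ideal f `<=` mm.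
Proof.
by refine (ideal_gen_sub edge_max_ideal _) => _ [i _ <-]; exact: lin_in_edge_max.
Qed.

Lemma lin_ideal_homog : homog_ideal (lin_ideal f).
Proof.
exists (range (fun i => pi (lin (row i f)))) => // _ [i _ <-].
exists 1%N, (lin (row i f)); split=> //; rewrite /lin rpred_sum // => j _.
by rewrite dhomogZ // dhomogX /= mdeg1.
Qed.

Lemma sum_lin_row (c : 'I_d -> k) :
  \sum_i c i *: pi (lin (row i f)) = pi (lin ((\row_i c i) *m f)).
Proof.
rewrite mulmx_sum_row linear_sum rmorph_sum; apply: eq_bigr => i _.
by rewrite linearZ /= edge_piZ mxE.
Qed.

(** Elements of m I have no linear part, so a relation between the generators modulo m I is already
    one between the rows of [f]. *)
Lemma lin_ideal_mu : row_free f -> has_mu (lin_ideal f) d.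
Proof.
move=> ff; have If : is_ideal (lin_ideal f) by exact: ideal_gen_ideal.
have Imf : is_ideal (ideal_mul mm (lin_ideal f)) by exact: ideal_gen_ideal.
exists (fun i => pi (lin (row i f))); split.
- exact: lin_ideal_gen.
- move=> c; rewrite sum_lin_row.
  have mf_sub : lin_ideal f `<=` lin_span 1%:M.
    by move=> x /lin_ideal_sub_max; exact: edge_max_lin_span.
  move=> /(ideal_mul_quad_span edge_max_lin_span mf_sub)[a [p p3 /eqP]].
  rewrite trmx1 mul1mx mulmx1 -subr_eq0 -rmorphB opprD addrA -[- qform a]linearN.
  move=> /eqP/edge_pi_eq0[].
    by rewrite -scaleN1r; exact: order_geZ.
  move=> /eqP; rewrite mulmx_free_eq0 // => /eqP/rowP c0 _ i.
  by have := c0 i; rewrite !mxE.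
have [I0 ID IM] := Imf; have [J0 JD JM] := If.
suff: lin_ideal f `<=` [set u | lin_ideal f u /\ exists c : 'I_d -> k,
    ideal_mul mm (lin_ideal f) (u - \sum_i c i *: pi (lin (row i f)))].
  by move=> sub u /sub[].
refine (ideal_gen_sub _ _); last first.
  move=> _ [i _ <-]; split; first exact: lin_ideal_gen.
  exists (fun j => (j == i)%:R); rewrite (bigD1 i) //= eqxx scale1r.
  by rewrite big1 ?addr0 ?subrr // => j /negPf ->; rewrite scale0r.
split.
- split=> //; exists (fun=> 0); rewrite big1 ?subrr // => i _; exact: scale0r.
- move=> x y [Jx [c cx]] [Jy [e ey]]; split; first exact: JD.
  exists (fun i => c i + e i); under eq_bigr do rewrite scalerDl.
  by rewrite big_split /= opprD addrACA; exact: ID.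
move=> a x [Jx [c cx]]; split; first exact: JM.
have [p ->] := edge_pi_surj a; have [q q1 ->] := order1P p.
exists (fun i => p@_0 * c i); under eq_bigr do rewrite -scalerA.
rewrite -scaler_sumr rmorphD mulrDl addrAC -[pi _%:MP * x]/(p@_0 *: x) -scalerBr.
apply: ID; first exact: (ideal_scale _ Imf).
by apply: sub_ideal_gen; exists (pi q), x; split=> //; exact: order1_edge_max.
Qed.

End LinearIdeal.

(** * Translation of cs and ms into spanning conditions *)

Lemma cs_le_spans d (f : 'M[k]_(d, n)) : spans G f f -> (cs k G <= d)%N.
Proof.
(* A basis of the row space replaces [f], since [lin_ideal_mu] needs independent rows; it has at
   most [d] elements. *)
move=> ff; have [fb bf] : (f <= row_base f)%MS /\ row_free (row_base f).
  by rewrite eq_row_base row_base_free.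
have bb := spans_subl fb (spans_subr fb ff).
rewrite /cs; case: ex_minnP => r _ /(_ (\rank f)) rmin.
apply: leq_trans (rank_leq_row f); apply: rmin; apply/asboolP.
exists (lin_ideal (row_base f)); split; last exact: lin_ideal_mu.
- exact: lin_ideal_sub_max.
- exact: lin_ideal_homog.
apply/seteqP; split; first by apply: ideal_mulS; exact: lin_ideal_sub_max.
exact: (edge_max2_sub_mul bb (@lin_ideal_gen _ _) (@lin_ideal_gen _ _)).
Qed.

Lemma ms_le_spans d (f : 'M[k]_(d, n)) : spans G 1%:M f -> (ms k G <= d)%N.
Proof.
move=> ff; have [fb bf] : (f <= row_base f)%MS /\ row_free (row_base f).
  by rewrite eq_row_base row_base_free.
have bb := spans_subr fb ff.
rewrite /ms; case: ex_minnP => r _ /(_ (\rank f)) rmin.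
apply: leq_trans (rank_leq_row f); apply: rmin; apply/asboolP.
exists (lin_ideal (row_base f)); split; last exact: lin_ideal_mu.
- exact: lin_ideal_sub_max.
- exact: lin_ideal_homog.
have := edge_max2_sub_mul bb (fun i => lin_in_edge_max _) (@lin_ideal_gen _ _).
move=> /subset_trans; apply; refine (ideal_gen_sub (ideal_gen_ideal _) _).
move=> _ [x [y [_ Jy ->]]]; have [_ _ JM] : is_ideal (lin_ideal (row_base f)).
  exact: ideal_gen_ideal.
exact: JM.
Qed.

(** A basis of J modulo m J gives linear parts [l] and quadratic parts [B]. As J lies in m, the
    error term in m J has order at least 2: the rows of [l] therefore span all linear parts of J,
    while quadratic parts are controlled only up to m J. *)
Lemma has_mu_parts (J : set A) d : J `<=` mm -> has_mu J d ->
  exists (l : 'M[k]_(d, n)) (B : 'I_d -> 'M[k]_n), J `<=` lin_span l /\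
  forall x, J x -> exists c : 'rV[k]_d, exists2 q,
    order_ge 3 q & ideal_mul mm J
      (x - pi (lin (c *m l) + \sum_t c 0 t *: qform (B t) + q)).
Proof.
move=> Jm [b [Jb _ Jspan]].
have /choice[w wE] t : exists w : 'rV[k]_n * 'M[k]_n * {mpoly k[n]},
    order_ge 3 w.2 /\ b t = pi (lin w.1.1 + (qform w.1.2 + w.2)).
  have [c [p p2 ->]] := edge_max_lin_span (Jm _ (Jb t)).
  by have [Z [q q3 ->]] := order3P p2; exists (c *m 1%:M, Z, q).
pose l := \matrix_t (w t).1.1 : 'M[k]_(d, n).
have parts x : J x -> exists c : 'rV[k]_d, exists2 q, order_ge 3 q &
    ideal_mul mm J (x - pi (lin (c *m l) + \sum_t c 0 t *: qform (w t).1.2 + q)).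
  move=> /Jspan[c cE]; exists (\row_t c t), (\sum_t c t *: (w t).2).
    by apply: order_ge_sum => t; apply: order_geZ; case: (wE t).
  move: cE; congr (ideal_mul _ _ (_ - _)).
  rewrite mulmx_sum_row linear_sum -!big_split rmorph_sum; apply: eq_bigr => t _ /=.
  by rewrite (wE t).2 -edge_piZ !scalerDr mxE linearZ rowK addrA.
exists l, (fun t => (w t).1.2); split=> // x /parts[c [q q3]].
have Jl : J `<=` lin_span 1%:M by move=> y /Jm; exact: edge_max_lin_span.
move=> /(ideal_mul_quad_span edge_max_lin_span Jl)[a [p p3 /eqP]].
rewrite subr_eq => /eqP ->; exists c.
exists (qform (1%:M^T *m a *m 1%:M) + p + \sum_t c 0 t *: qform (w t).1.2 + q).
  apply: order_geD; last exact: order_ge_leq q3.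
  apply: order_geD.
    by apply: order_geD; [exact: order_qform|exact: order_ge_leq p3].
  by apply: order_ge_sum => t; apply: order_geZ; exact: order_qform.
by rewrite -rmorphD; congr pi; rewrite !addrA; congr (_ + _ + _); rewrite addrC !addrA.
Qed.

(** Every quadratic form lies in J^2, where quadratic parts are combinations of products of linear
    parts of J; the quadratic parts of generators never enter. *)
Lemma cs_spans : exists l : 'M[k]_(cs k G, n), spans G l l.
Proof.
rewrite /cs; case: ex_minnP => d /asboolP[J [Jm _ J2 Jmu]] _.
have [l [_ [Jl _]]] := has_mu_parts Jm Jmu; exists l => X.
have := qform_edge_max2 X; rewrite -J2 => /(ideal_mul_quad_span Jl Jl)[a [p p3 /eqP]].
have E : qform X - (qform (l^T *m a *m l) + p) =
    lin 0 + qform (X - l^T *m a *m l) - p.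
  by rewrite linear0 add0r linearB opprD addrA.
rewrite -subr_eq0 -rmorphB E => /eqP/edge_pi_eq0[].
  by rewrite -scaleN1r; exact: order_geZ.
by move=> _; exists a.
Qed.

(** A quadratic form in J may use the quadratic parts of generators, with coefficients [c] whose
    linear parts cancel. Comparing degrees 1 and 2 yields exactly the hypothesis of
    [spans_exchange]. *)
Lemma ms_spans : exists l : 'M[k]_(ms k G, n), spans G 1%:M l.
Proof.
rewrite /ms; case: ex_minnP => d /asboolP[J [Jm _ J2 Jmu]] _.
have [l [B [Jl parts]]] := has_mu_parts Jm Jmu; apply: (@spans_exchange _ _ _ _ l B) => X.
have [c [q q3]] := parts _ (J2 _ (qform_edge_max2 X)).
move=> /(ideal_mul_quad_span edge_max_lin_span Jl)[a [p p3 /eqP]].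
rewrite trmx1 mul1mx -subr_eq0 -!rmorphB.
have -> : qform X - (lin (c *m l) + \sum_t c 0 t *: qform (B t) + q) -
    (qform (a *m l) + p) =
  lin (- (c *m l)) + qform (X - \sum_t c 0 t *: B t - a *m l) + (- q - p).
  rewrite (linearN (@lin k n)) !linearB /=.
  have -> : qform (\sum_t c 0 t *: B t) = \sum_t c 0 t *: qform (B t).
    by rewrite linear_sum; apply: eq_bigr => t _; rewrite linearZ.
  ring.
move=> /eqP/edge_pi_eq0[].
  by rewrite -opprD -scaleN1r; apply/order_geZ/order_geD.
by move=> /eqP; rewrite oppr_eq0 => /eqP cl Z0; exists c, a.
Qed.

End EdgeRing.

Theorem proposition6p42 (k : fieldType) (m n : nat) (m_gt0 : 0 < m)
    (n_gt0 : 0 < n) (G : sgraph m) (H : sgraph n) :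
  ms k (join G H) = maxn (ms k G) (ms k H) /\
  maxn (cs k G) (cs k H) <= cs k (join G H) <= cs k G + cs k H.
Proof.
split.
  apply/eqP; rewrite eqn_leq geq_max; apply/and3P; split.
  - have [f fG] := ms_spans k G; have [g gH] := ms_spans k H.
    have [f' fG'] := spans_pad (leq_maxl _ (ms k H)) fG.
    have [g' gH'] := spans_pad (leq_maxr (ms k G) _) gH.
    exact: ms_le_spans (spans_join_row fG' gH').
  - have [l lGH] := ms_spans k (join G H).
    apply: (@ms_le_spans _ _ _ _ (lsubmx l)).
    (* Restricting the identity to the vertices of G gives a matrix with extra zero rows; its row
       space is contained in that of the identity of size [m]. *)
    apply: spans_subl (spans_join_l lGH); exact: submx1.
  have [l lGH] := ms_spans k (join G H).
  apply: (@ms_le_spans _ _ _ _ (rsubmx l)).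
  apply: spans_subl (spans_join_r lGH); exact: submx1.
rewrite geq_max -andbA; apply/and3P; split.
- have [l lGH] := cs_spans k (join G H); exact: cs_le_spans (spans_join_l lGH).
- have [l lGH] := cs_spans k (join G H); exact: cs_le_spans (spans_join_r lGH).
have [f fG] := cs_spans k G; have [g gH] := cs_spans k H.
exact: cs_le_spans (spans_join_block fG gH).
Qed.
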